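(* Let $\overline{A}=(A_1,\dots,A_X)$ be a cardinality with associated space $\mathcal{A}$, and let $\mathsf{S}^*,\mathsf{Z}^*,\mathsf{C}^*\subseteq\mathcal{A}^*$ be the subspaces of linear forms defined in the context. Then the dual space $\mathcal{A}^*$ decomposes as the series of subspaces $$0\subseteq\mathsf{S}^*\subseteq\mathsf{S}^*\oplus\mathsf{Z}^*\subseteq\mathsf{S}^*\oplus\mathsf{Z}^*\oplus\mathsf{C}^*=\mathcal{A}^*,$$ each of which is invariant under local transformations $\Lambda:\mathcal{A}\to\mathcal{A}$ acting by $\Phi\mapsto\Phi\Lambda$, and this decomposition is unique: after deleting repeated terms, this chain is the one and only chain from $0$ to $\mathcal{A}^*$ of invariant subspaces of $\mathcal{A}^*$ whose successive quotients are irreducible.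
   Context: A cardinality $\overline{A}=(A_1,\dots,A_X)$ is a finite nonempty sequence of positive integers: a device has inputs $x\in\{1,\dots,X\}$ and, for input $x$, outputs $a\in\{1,\dots,A_x\}$. The associated space is $\mathcal{A}=\mathbb{R}^{\sum_x A_x}$ with standard basis vectors $[a|x]$; $[a|x]^*\in\mathcal{A}^*$ denotes the dual standard basis. A deterministic local map $\mathcal{A}\to\mathcal{A}$ is determined by $\xi:\{1,\dots,X\}\to\{1,\dots,X\}$ and $\alpha_{x'}:\{1,\dots,A_{\xi(x')}\}\to\{1,\dots,A_{x'}\}$; its matrix has entry $\Lambda_{(a',x'),(a,x)}=1$ if $x=\xi(x')$ and $a'=\alpha_{x'}(a)$, and $0$ otherwise. A local transformation is a convex mixture of deterministic local maps. It acts on linear forms $\Phi\in\mathcal{A}^*$ by $\Phi\mapsto\Phi\Lambda$ (composition). A subspace of $\mathcal{A}^*$ is invariant if it is mapped into itself by this action for every local transformation $\Lambda:\mathcal{A}\to\mathcal{A}$; a quotient of invariant subspaces is irreducible if it has no invariant subspace other than $0$ and itself for the induced action. Define $\sigma^x=\sum_{a=1}^{A_x}[a|x]^*$ for $x\in\{1,\dots,X\}$; $\tau=\frac1X\sum_{x=1}^X\sigma^x$; $\overline{\sigma}^{\,k}=\frac1X(\sigma^k-\sigma^X)$ for $k\in\{1,\dots,X-1\}$; $\gamma^{i|x}=A_x[i|x]^*-\sum_{a=1}^{A_x}[a|x]^*$ for $x\in\{1,\dots,X\}$, $i\in\{1,\dots,A_x-1\}$; and $\mathsf{Z}^*=\mathrm{span}(\tau)$,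 $\mathsf{S}^*=\mathrm{span}\{\overline{\sigma}^{\,k}\}_k$, $\mathsf{C}^*=\mathrm{span}\{\gamma^{i|x}\}_{i,x}$. *)

(* Defs.v *)
From HB Require Import structures.
From mathcomp Require Import all_boot all_order all_algebra.
From mathcomp Require Import reals.

Set Implicit Arguments.
Unset Strict Implicit.
Unset Printing Implicit Defensive.

Import Order.TTheory GRing.Theory Num.Theory.
Local Open Scope ring_scope.

Section Quotient.
Variables (K : fieldType) (vT : vectType K).

(* The quotient space vT / U, realised on the complement U^C chosen by the
   library. [lker_quot_map] and [limg_quot_map] say that [quot_map U] is a
   linear surjection with kernel U, i.e. the quotient map. *)
Definition quotv (U : {vspace vT}) := subvs_of (U^C)%VS.

Definition quot_map (U : {vspace vT}) : 'Hom(vT, quotv U) :=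
  linfun (fun v : vT => vsproj (U^C)%VS (daddv_pi (U^C)%VS U v)).

Lemma capCv (U : {vspace vT}) : (U^C :&: U = 0)%VS.
Proof. by rewrite capvC capv_compl. Qed.

Lemma quot_mapE U v : vsval (quot_map U v) = daddv_pi (U^C)%VS U v.
Proof.
pose q : {linear vT -> quotv U} := vsproj (U^C)%VS \o daddv_pi (U^C)%VS U.
by rewrite (lfunE q v) /= vsprojK // memv_pi.
Qed.

Lemma lker_quot_map U : lker (quot_map U) = U.
Proof.
have dec v : daddv_pi (U^C)%VS U v + daddv_pi U (U^C)%VS v = v.
  by rewrite daddv_pi_add ?capCv // addvC addv_complf memvf.
apply/vspaceP => v; rewrite memv_ker; apply/eqP/idP => [q0 | Uv].
  by rewrite -(dec v) -quot_mapE q0 linear0 add0r memv_pi.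
apply: val_inj; rewrite [LHS]quot_mapE.
move: (dec v); rewrite (daddv_pi_id (capv_compl U) Uv).
by move/(canRL (addrK _)) ->; rewrite subrr.
Qed.

Lemma limg_quot_map U : limg (quot_map U) = fullv.
Proof.
apply/vspaceP => w; rewrite memvf; apply/memv_imgP.
exists (vsval w); first exact: memvf.
by apply: val_inj; rewrite [RHS]quot_mapE daddv_pi_id ?capCv // subvsP.
Qed.

End Quotient.

Section Devices.
Variables (R : realType) (n : nat).

(* X = n.+1 inputs, so that the cardinality is nonempty; A x is the number of
   outputs for input x. Inputs and outputs are numbered from 0, so the last
   input X is [ord_max]. *)
Variable A : 'I_n.+1 -> nat.

(* Tagged a : event, for a : 'I_(A x), is the index a|x. *)
Definition event : finType := {x : 'I_n.+1 & 'I_(A x)}.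

Definition ev (x : 'I_n.+1) (a : 'I_(A x)) : event :=
  Tagged (fun x => 'I_(A x)) a.

Definition space : vectType R := {ffun event -> R^o}.

Definition dual : vectType R := 'Hom(space, R^o).

Definition dualb (j : event) : dual := linfun (fun v : space => v j).

Lemma dualbE j v : dualb j v = v j.
Proof.
have lin : linear (fun v : space => v j : R^o) by move=> k u w; rewrite !ffunE.
pose f : {linear space -> R^o} := HB.pack (fun v : space => v j : R^o)
  (GRing.isLinear.Build _ _ _ _ _ lin).
exact: (lfunE f v).
Qed.

Section Deterministic.
Variables (xi : 'I_n.+1 -> 'I_n.+1)
  (alpha : forall x', 'I_(A (xi x')) -> 'I_(A x')).

(* The entry at row j = a'|x' and column i = a|x; the existential over outputs
   of input xi x' states x = xi x' and a' = alpha_x' a without a cast. *)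
Definition det_entry (j i : event) : R :=
  [exists a : 'I_(A (xi (tag j))),
     (i == ev a) && (tagged j == alpha a)]%:R.

Definition det_map : 'End(space) :=
  linfun (fun v : space =>
    [ffun j => \sum_(i : event) det_entry j i * v i] : space).

Lemma det_mapE v j : det_map v j = \sum_(i : event) det_entry j i * v i.
Proof.
pose g (v : space) : space := [ffun j => \sum_(i : event) det_entry j i * v i].
have lin : linear g.
  move=> k u w; apply/ffunP => l; rewrite !ffunE scaler_sumr -big_split /=.
  by apply: eq_bigr => i _; rewrite !ffunE mulrDr mulrCA.
pose f : {linear space -> space} :=
  HB.pack g (GRing.isLinear.Build _ _ _ _ _ lin).
by rewrite /det_map (lfunE f v) ffunE.
Qed.

End Deterministic.

Definition deterministic_local (L : 'End(space)) : Prop :=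
  exists (xi : 'I_n.+1 -> 'I_n.+1)
         (alpha : forall x', 'I_(A (xi x')) -> 'I_(A x')),
    L = det_map alpha.

Definition local_transformation (L : 'End(space)) : Prop :=
  exists (k : nat) (p : 'I_k -> R) (D : 'I_k -> 'End(space)),
    [/\ forall i, 0 <= p i,
        \sum_i p i = 1,
        forall i, deterministic_local (D i)
      & L = \sum_i p i *: D i].

Definition act (Phi : dual) (L : 'End(space)) : dual := (Phi \o L)%VF.

Definition invariant_subspace (U : {vspace dual}) : Prop :=
  forall L, local_transformation L -> forall Phi, Phi \in U -> act Phi L \in U.

(* For invariant U, the induced action on dual / U maps the class of Phi to the
   class of act Phi L. *)
Definition quot_invariant (U : {vspace dual}) (W : {vspace quotv U}) : Prop :=
  forall L, local_transformation L ->
  forall Phi, quot_map U Phi \in W -> quot_map U (act Phi L) \in W.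

(* V / U, for U <= V, is the image of V in dual / U. *)
Definition irreducible_quotient (U V : {vspace dual}) : Prop :=
  forall W : {vspace quotv U}, (W <= quot_map U @: V)%VS ->
    quot_invariant W -> W = 0%VS \/ W = (quot_map U @: V)%VS.

(* Consecutive terms are distinct: the zero quotient satisfies
   [irreducible_quotient], so repetitions have to be excluded here. *)
Definition irreducible_chain (s : seq {vspace dual}) : Prop :=
  [/\ ohead s = Some 0%VS,
      last 0%VS s = fullv,
      sorted (fun U V => (U <= V)%VS && (U != V)) s,
      forall U, U \in s -> invariant_subspace U
    & forall i, (i.+1 < size s)%N ->
        irreducible_quotient (nth 0%VS s i) (nth 0%VS s i.+1)].

Definition sigma (x : 'I_n.+1) : dual := \sum_(a < A x) dualb (ev a).

Definition tau : dual := n.+1%:R^-1 *: \sum_x sigma x.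

(* [lift ord_max k] is k seen as an input other than the last one. *)
Definition sigma_bar (k : 'I_n) : dual :=
  n.+1%:R^-1 *: (sigma (lift ord_max k) - sigma ord_max).

Definition gamma (j : event) : dual :=
  (A (tag j))%:R *: dualb j - sigma (tag j).

Definition Zstar : {vspace dual} := <[tau]>%VS.

Definition Sstar : {vspace dual} := <<[seq sigma_bar k | k : 'I_n]>>%VS.

(* For each input x, the index i|x runs over all outputs of x but the last. *)
Definition Cstar : {vspace dual} :=
  <<[seq gamma j | j in [pred j : event | (tagged j).+1 < A (tag j)]%N]>>%VS.

End Devices.

(* Main.v *)
(* The invariant subspaces of the dual are exactly 0, S, S+Z and the whole dual,
   and these form a chain, so the only chain with irreducible quotients runs
   through all of them. Let Phi be a nonzero element of an invariant subspace U.
   If Phi is constant on the outputs of each input, then Phi = sum_x c_x sigma^x,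
   and a deterministic map sends sigma^x to sigma^(xi x): a constant xi yields
   (sum_x c_x) sigma^y for every y, and if sum_x c_x = 0 a two-valued xi yields
   c_x (sigma^y - sigma^z). Otherwise, take two deterministic maps with the same
   constant xi = y whose alpha differ only at the output i of y: the difference of
   the images of Phi is a multiple of [i|y]^*, nonzero for a suitable choice of
   the maps, so U is everything. *)
Require Import Defs.
From mathcomp Require Import all_boot all_order all_algebra.
From mathcomp Require Import reals.
Import Order.TTheory GRing.Theory Num.Theory.
Local Open Scope ring_scope.

Set Implicit Arguments.
Unset Strict Implicit.
Unset Printing Implicit Defensive.

(** * Linear algebra: spans, quotient maps and strictly increasing chains *)

Lemma span_ind (K : fieldType) (vT : vectType K) (P : vT -> Prop) (X : seq vT) :
  P 0 -> (forall u v, P u -> P v -> P (u + v)) ->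
  (forall k u, P u -> P (k *: u)) -> {in X, forall u, P u} ->
  forall v, v \in <<X>>%VS -> P v.
Proof.
move=> P0 PD PZ PX v Xv; rewrite (coord_span (X := in_tuple X) Xv).
by elim/big_ind: _ => // i _; apply: PZ; apply: PX; apply: mem_nth.
Qed.

Section QuotientChains.
Variables (K : fieldType) (vT : vectType K).
Implicit Types U V : {vspace vT}.

Definition propersubv U V := (U <= V)%VS && (U != V).

Lemma propersubv_trans : transitive propersubv.
Proof.
move=> V U W /andP[UV nUV] /andP[VW nVW]; apply/andP; split.
  exact: subv_trans UV VW.
by apply: contraNneq nVW => UW; rewrite eqEsubv VW -UW.
Qed.

Lemma propersubvv : irreflexive propersubv.
Proof. by move=> U; rewrite /propersubv eqxx andbF. Qed.

(** As [V] contains the kernel [U], it is a union of cosets of [U], so its image loses no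
    information. *)
Lemma mem_quot_map_img U V v :
  (U <= V)%VS -> (quot_map U v \in (quot_map U @: V)%VS) = (v \in V).
Proof.
move=> UV; apply/idP/idP => [/memv_imgP[w Vw e] | ]; last exact: memv_img.
rewrite -(subrK w v) memvD //; apply: (subvP UV).
by rewrite -(lker_quot_map U) memv_ker linearB /= e subrr.
Qed.

(** By transitivity, sortedness is a condition on all pairs, and after [undup] all pairs are
    distinct; so weak inclusions become strict. *)
Lemma sorted_subv_undup (s : seq {vspace vT}) :
  sorted (fun U V => (U <= V)%VS) s -> sorted propersubv (undup s).
Proof.
move=> ss; have tr : transitive (fun U V => (U <= V)%VS).
  by move=> V U W; apply: subv_trans.
have := subseq_sorted tr (undup_subseq s) ss.
rewrite (sorted_pairwise tr) (sorted_pairwise propersubv_trans).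
move: (undup_uniq s); rewrite uniq_pairwise => pu pl.
by rewrite pairwise_relI pl andTb.
Qed.

(** The index of [W] in [s] cannot be below [i] or above [i.+1], since either would give a strict
    inclusion opposite to an assumed one. *)
Lemma between_nth_sorted (s : seq {vspace vT}) W i :
  sorted propersubv s -> (i.+1 < size s)%N -> W \in s ->
  (nth 0%VS s i <= W)%VS -> (W <= nth 0%VS s i.+1)%VS ->
  W = nth 0%VS s i \/ W = nth 0%VS s i.+1.
Proof.
move=> ss lis sW; set j := index W s.
have lj : (j < size s)%N by rewrite index_mem.
have <- : nth 0%VS s j = W by rewrite nth_index.
have mono := sorted_ltn_nth propersubv_trans 0%VS ss.
have [ji | ij | -> ] := ltngtP j i; last by left.
  move=> Ujs _; have := mono j i lj (ltnW lis) ji.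
  by rewrite /propersubv eqEsubv Ujs andbT andbN.
have [ji | ij1 | -> ] := ltngtP j i.+1; last by right.
  by move: (leq_trans ji ij); rewrite ltnn.
move=> _ Ujs; have := mono i.+1 j lis lj ij1.
by rewrite /propersubv eqEsubv Ujs andbT andbN.
Qed.

Lemma ohead_sorted (s : seq {vspace vT}) :
  sorted propersubv s -> 0%VS \in s -> ohead s = Some 0%VS.
Proof.
case: s => // U s /(order_path_min propersubv_trans)/allP Us.
rewrite inE => /predU1P[-> // | /Us].
by rewrite /propersubv subv0 andbN.
Qed.

Lemma last_sorted (s : seq {vspace vT}) :
  sorted propersubv s -> fullv \in s -> last 0%VS s = fullv.
Proof.
rewrite (sorted_pairwise propersubv_trans).
case/lastP: s => // s U; rewrite pairwise_rcons last_rcons => /andP[/allP Us _].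
rewrite mem_rcons inE => /predU1P[-> // | /Us].
by rewrite /propersubv eqEsubv subvf andbT andbN.
Qed.

End QuotientChains.

(** * Coordinates on the dual and the action of deterministic maps *)

Section Devices.
Variables (R : realType) (n : nat) (A : 'I_n.+1 -> nat).
Local Notation space := (Defs.space R A).
Local Notation dual := (dual R A).
Implicit Types (Phi : dual) (U V : {vspace dual}).

Lemma ev_inj x : injective (@ev n A x).
Proof.
move=> a b e; have := congr1 (tagged_as (ev a)) e.
by rewrite !tagged_asE.
Qed.

Lemma sum_event (M : nmodType) (F : event A -> M) :
  \sum_j F j = \sum_x \sum_(a < A x) F (ev a).
Proof.
rewrite (sig_big_dep (fun=> true) (fun _ _ => true) (fun x a => F (ev a))) /=.
by apply: eq_bigr => -[x a].
Qed.

(** The basis vector [a|x]; [Phi (delta (ev a))] is thus the coefficient of [a|x]^* in [Phi]. *)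
Definition delta (j : event A) : space := [ffun i => (i == j)%:R].

Lemma space_sum_delta (v : space) : v = \sum_j v j *: delta j.
Proof.
apply/ffunP => i; rewrite sum_ffunE (bigD1 i) //= big1 => [|j ij].
  by rewrite !ffunE eqxx addr0; apply/esym/mulr1.
by rewrite !ffunE eq_sym (negPf ij); apply/mulr0.
Qed.

Lemma dual_apply Phi v :
  Phi v = \sum_x \sum_(a < A x) v (ev a) * Phi (delta (ev a)).
Proof.
rewrite {1}(space_sum_delta v) linear_sum sum_event.
by apply: eq_bigr => x _; apply: eq_bigr => a _; rewrite linearZ.
Qed.

Lemma dual_sum_dualb Phi :
  Phi = \sum_x \sum_(a < A x) Phi (delta (ev a)) *: dualb R (ev a).
Proof.
apply/lfunP => v; rewrite dual_apply sum_lfunE; apply: eq_bigr => x _.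
rewrite sum_lfunE; apply: eq_bigr => a _.
by rewrite scale_lfunE dualbE; apply: mulrC.
Qed.

Lemma sigmaE x (v : space) : sigma R A x v = \sum_(a < A x) v (ev a).
Proof. by rewrite sum_lfunE; apply: eq_bigr => a _; rewrite dualbE. Qed.

Section Deterministic.
Variables (xi : 'I_n.+1 -> 'I_n.+1)
  (alpha : forall x', 'I_(A (xi x')) -> 'I_(A x')).

Lemma det_map_apply (v : space) x' (a' : 'I_(A x')) :
  det_map R alpha v (ev a') =
  \sum_(a < A (xi x')) (a' == alpha a)%:R * v (ev a).
Proof.
rewrite det_mapE.
(* By injectivity of [ev], at most one output witnesses the existential in [det_entry], so it can be
   traded for a sum of indicators. *)
have entryE i : det_entry R alpha (ev a') i =
    \sum_(a < A (xi x')) (i == ev a)%:R * (a' == alpha a)%:R.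
  rewrite /det_entry /=; case: existsP => [[a /andP[/eqP-> /eqP ea]] | no].
    rewrite (bigD1 a) //= big1 => [|b ba].
      by rewrite eqxx ea eqxx mulr1 addr0.
    by rewrite (inj_eq (@ev_inj _)) eq_sym (negPf ba) mul0r.
  rewrite big1 // => a _; apply/eqP; rewrite -natrM mulnb pnatr_eq0 eqb0.
  by apply/negP => ia; apply: no; exists a.
under eq_bigr do rewrite entryE big_distrl /=.
rewrite exchange_big /=; apply: eq_bigr => a _.
rewrite (bigD1 (ev a)) //= big1 => [|i /negPf->]; last by rewrite !mul0r.
by rewrite eqxx mul1r addr0.
Qed.

(** The transposed action in coordinates: each input x' moves the coefficient of [Phi] at
    alpha_x'(a)|x' to a|xi(x'). Summing over x' rather than over the fibres of [xi] avoids casts. *)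
Lemma act_det_map Phi v :
  act Phi (det_map R alpha) v =
  \sum_x' \sum_(a < A (xi x')) Phi (delta (ev (alpha a))) * v (ev a).
Proof.
rewrite comp_lfunE dual_apply; apply: eq_bigr => x' _.
under eq_bigr do rewrite det_map_apply big_distrl /=.
rewrite exchange_big /=; apply: eq_bigr => a _.
rewrite (bigD1 (alpha a)) //= big1 => [|i /negPf->]; last by rewrite !mul0r.
by rewrite eqxx mul1r addr0 mulrC.
Qed.

(** Every output of [xi x] is sent to exactly one output of [x], so summing over the latter forgets
    [alpha]. *)
Lemma act_sigma x : act (sigma R A x) (det_map R alpha) = sigma R A (xi x).
Proof.
apply/lfunP => v; rewrite comp_lfunE !sigmaE.
under eq_bigr do rewrite det_map_apply.
rewrite exchange_big /=; apply: eq_bigr => a _.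
rewrite (bigD1 (alpha a)) //= big1 => [|i /negPf->]; last by rewrite mul0r.
by rewrite eqxx mul1r addr0.
Qed.

End Deterministic.

Lemma actD L Phi Psi : act (Phi + Psi) L = act Phi L + act Psi L.
Proof. exact: comp_lfunDl. Qed.

Lemma actZ L k Phi : act (k *: Phi) L = k *: act Phi L.
Proof. exact/esym/comp_lfunZl. Qed.

Lemma act_sum (I : finType) (F : I -> dual) L :
  act (\sum_i F i) L = \sum_i act (F i) L.
Proof.
apply/lfunP => v; rewrite comp_lfunE !sum_lfunE.
by apply: eq_bigr => i _; rewrite comp_lfunE.
Qed.

(** A deterministic map is a mixture with one term, and a mixture acts by a linear combination of
    deterministic actions. *)
Lemma invariant_subspaceP U :
  invariant_subspace U <->
  (forall xi (alpha : forall x', 'I_(A (xi x')) -> 'I_(A x')) Phi,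
     Phi \in U -> act Phi (det_map R alpha) \in U).
Proof.
split=> [invU xi alpha Phi | detU L [k [p [D [_ _ detD ->]]]] Phi UPhi].
  apply: invU; exists 1%N, (fun=> 1), (fun=> det_map R alpha).
  split=> [i||i|]; rewrite ?ler01 ?big_ord1 ?scale1r //.
  by exists xi, alpha.
have -> : act Phi (\sum_i p i *: D i) = \sum_i p i *: act Phi (D i).
  apply/lfunP => v; rewrite comp_lfunE !sum_lfunE linear_sum.
  by apply: eq_bigr => i _; rewrite !scale_lfunE linearZ comp_lfunE.
rewrite memv_suml // => i _; rewrite memvZ //.
by have [xi [alpha ->]] := detD i; apply: detU.
Qed.

Lemma invariant_0 : invariant_subspace (0%VS : {vspace dual}).
Proof. by move=> L _ Phi; rewrite !memv0 => /eqP->; rewrite /act comp_lfun0l. Qed.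

Lemma invariant_fullv : invariant_subspace (fullv : {vspace dual}).
Proof. by move=> L _ Phi _; apply: memvf. Qed.

Lemma invariant_span (X : seq dual) :
  (forall xi (alpha : forall x', 'I_(A (xi x')) -> 'I_(A x')) Phi,
     Phi \in X -> act Phi (det_map R alpha) \in <<X>>%VS) ->
  invariant_subspace <<X>>%VS.
Proof.
move=> XX; apply/invariant_subspaceP => xi alpha.
apply: span_ind => [|u v|k u|u]; rewrite ?actD ?actZ.
- by rewrite /act comp_lfun0l mem0v.
- exact: memvD.
- exact: memvZ.
- exact: XX.
Qed.


(** * The subspaces S and S + Z in terms of the sigma^x, and their invariance *)

Local Notation sigma := (sigma R A).
Local Notation tau := (tau R A).
Local Notation S := (Sstar R A).
Local Notation Z := (Zstar R A).
Local Notation C := (Cstar R A).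

Let nS_neq0 : n.+1%:R != 0 :> R.
Proof. by rewrite pnatr_eq0. Qed.

Lemma sigmaB_mem x y : sigma x - sigma y \in S.
Proof.
have last z : sigma z - sigma ord_max \in S.
  case: (unliftP ord_max z) => [k|] ->; last by rewrite subrr mem0v.
  rewrite -[_ - _](scalerKV nS_neq0) memvZ // memv_span //.
  by apply/imageP; exists k.
by rewrite -(subrKA (sigma ord_max)) -[_ - sigma y]opprB rpredB.
Qed.

Lemma sigma_mem x : sigma x \in (S + Z)%VS.
Proof.
rewrite -(subrK tau (sigma x)) memv_add ?memv_line //.
(* As [tau] is the average of the sigma^y, this difference is an average of differences lying in
   S. *)
have -> : sigma x - tau = n.+1%:R^-1 *: \sum_y (sigma x - sigma y).
  rewrite sumrB sumr_const card_ord scalerBr -scaler_nat scalerA.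
  by rewrite mulVf // scale1r.
by apply/memvZ/memv_suml => y _; apply: sigmaB_mem.
Qed.

(** The zero sum of the coefficients, preserved by linear combinations, is what distinguishes S
    inside S + Z. *)
Lemma memSP Phi :
  Phi \in S -> exists c, \sum_x c x = 0 /\ Phi = \sum_x c x *: sigma x.
Proof.
move: Phi; apply: span_ind => [|u v [c [c0 ->]] [d [d0 ->]]|k u [c [c0 ->]]|u].
- by exists (fun=> 0); rewrite !big1 // => x _; rewrite scale0r.
- exists (fun x => c x + d x); rewrite !big_split /= c0 d0 addr0; split=> //.
  by rewrite -big_split; apply: eq_bigr => x _; rewrite scalerDl.
- exists (fun x => k * c x); rewrite -mulr_sumr c0 mulr0; split=> //.
  by rewrite scaler_sumr; apply: eq_bigr => x _; rewrite scalerA.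
(* [e y] is the coefficient family of [sigma y]; a generator of S is a scaled difference of two of
   these. *)
case/imageP => k _ ->; pose e y x : R := (x == y :> 'I_n.+1)%:R.
have sum1 y : \sum_x e y x = 1.
  by rewrite (bigD1 y) //= big1 /e ?eqxx ?addr0 // => x /negPf->.
have sumsigma y : \sum_x e y x *: sigma x = sigma y.
  rewrite (bigD1 y) //= big1 /e ?eqxx ?addr0 ?scale1r // => x /negPf->.
  by rewrite scale0r.
exists (fun x => n.+1%:R^-1 * (e (lift ord_max k) x - e ord_max x)).
rewrite -mulr_sumr sumrB !sum1 subrr mulr0; split=> //.
under eq_bigr do rewrite -scalerA scalerBl.
by rewrite -scaler_sumr sumrB !sumsigma.
Qed.

Lemma memSZP Phi :
  Phi \in (S + Z)%VS -> exists c, Phi = \sum_x c x *: sigma x.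
Proof.
case/memv_addP => u /memSP[c [_ ->]] [_ /vlineP[k ->] ->].
exists (fun x => c x + k * n.+1%:R^-1).
rewrite scalerA scaler_sumr -big_split.
by apply: eq_bigr => x _; rewrite scalerDl.
Qed.

Lemma memSZ_const (a : forall x, 'I_(A x)) Phi :
  (forall x (b : 'I_(A x)), Phi (delta (ev b)) = Phi (delta (ev (a x)))) ->
  Phi \in (S + Z)%VS.
Proof.
move=> constPhi; rewrite (dual_sum_dualb Phi); apply: memv_suml => x _.
under eq_bigr do rewrite constPhi.
by rewrite -scaler_sumr memvZ // sigma_mem.
Qed.

Lemma invariant_S : invariant_subspace S.
Proof.
apply: invariant_span => xi alpha _ /imageP[k _ ->].
by rewrite actZ actD -scaleN1r actZ scaleN1r !act_sigma memvZ // sigmaB_mem.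
Qed.

Lemma invariant_SZ : invariant_subspace (S + Z)%VS.
Proof.
apply/invariant_subspaceP => xi alpha _ /memSZP[c ->].
rewrite act_sum; apply: memv_suml => x _.
by rewrite actZ act_sigma memvZ // sigma_mem.
Qed.

(** * Classification of the invariant subspaces *)

Hypothesis Apos : forall x, (0 < A x)%N.

Let outp0 x : 'I_(A x) := Ordinal (Apos x).

(** Only [xi] matters for the image of sigma^x, so [alpha] may be taken constant at the first
    outputs. *)
Lemma act_comb_sigma U (xi : 'I_n.+1 -> 'I_n.+1) (c : 'I_n.+1 -> R) :
  invariant_subspace U -> \sum_x c x *: sigma x \in U ->
  \sum_x c x *: sigma (xi x) \in U.
Proof.
move/invariant_subspaceP => invU.
move/(invU xi (fun x _ => outp0 x)); rewrite act_sum.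
by under eq_bigr do rewrite actZ act_sigma.
Qed.

Lemma invariant_in_S U :
  invariant_subspace U -> (U <= S)%VS -> U != 0%VS -> U = S.
Proof.
move=> invU US U0; apply/eqP; rewrite eqEsubv US /=.
have [c [c0 eU]] := memSP (subvP US _ (memv_pick U)).
have [x cx0] : exists x, c x != 0.
  apply/existsP; apply: contraNT U0; rewrite negb_exists => /forallP c00.
  rewrite -vpick0 eU big1 // => x _.
  by move: (c00 x); rewrite negbK => /eqP->; rewrite scale0r.
have sub y z : sigma y - sigma z \in U.
  have := memv_pick U; rewrite eU.
  move/(act_comb_sigma (fun x' => if x' == x then y else z) invU).
  rewrite (bigD1 x) //= eqxx.
  under eq_bigr => x' /negPf-> do [].
  rewrite -scaler_suml.
  (* The coefficients other than [c x], now all attached to [sigma z], add up to [- c x]. *)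
  move: c0; rewrite (bigD1 x) //= => /eqP; rewrite addrC addr_eq0 => /eqP->.
  by rewrite scaleNr -scalerBr rpredZeq (negPf cx0).
by apply/span_subvP => _ /imageP[k _ ->]; rewrite memvZ.
Qed.

Lemma invariant_in_SZ U :
  invariant_subspace U -> (U <= S + Z)%VS -> ~~ (U <= S)%VS -> U = (S + Z)%VS.
Proof.
move=> invU USZ /subvPn[Phi UPhi nSPhi]; apply/eqP; rewrite eqEsubv USZ /=.
have [c ePhi] := memSZP (subvP USZ _ UPhi); rewrite {}ePhi in UPhi nSPhi.
have c0 : \sum_x c x != 0.
  apply: contraNneq nSPhi => c0.
  (* With zero sum, subtracting a fixed [sigma ord0] from every term changes nothing and puts [Phi]
     in S. *)
  have -> : \sum_x c x *: sigma x = \sum_x c x *: (sigma x - sigma ord0).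
    under [RHS]eq_bigr do rewrite scalerBr.
    by rewrite sumrB -scaler_suml c0 scale0r subr0.
  by apply: memv_suml => x _; rewrite memvZ // sigmaB_mem.
have Usigma y : sigma y \in U.
  have := act_comb_sigma (fun=> y) invU UPhi.
  by rewrite -scaler_suml rpredZeq (negPf c0).
rewrite subv_add -memvE; apply/andP; split.
  by apply/span_subvP => _ /imageP[k _ ->]; rewrite memvZ // memvB.
by apply/memvZ/memv_suml.
Qed.

Lemma invariant_notin_SZ U :
  invariant_subspace U -> ~~ (U <= S + Z)%VS -> U = fullv.
Proof.
move=> invU /subvPn[Phi UPhi nSZPhi].
have [x [b nconst]] : exists x (b : 'I_(A x)),
    Phi (delta (ev b)) != Phi (delta (ev (outp0 x))).
  have [/existsP[x /existsP[b]]|] := boolP [exists x, exists b : 'I_(A x),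
    Phi (delta (ev b)) != Phi (delta (ev (outp0 x)))]; first by exists x, b.
  rewrite negb_exists => /forallP all_const; case/negP: nSZPhi.
  apply: (@memSZ_const outp0) => x b; apply/eqP.
  by move: (all_const x); rewrite negb_exists => /forallP/(_ b); rewrite negbK.
have Udual y (i : 'I_(A y)) : dualb R (ev i) \in U.
  (* Only output [i] of [y] is sent to a choice [g]; [dfwith outp0 b] alters the default choice at
     [x] alone, where [Phi] is not constant. The two maps thus differ in a single entry pair, at [x]
     and [i]. *)
  pose alpha g (x' : 'I_n.+1) (a : 'I_(A y)) : 'I_(A x') :=
    if a == i then g x' else outp0 x'.
  have Uact g : act Phi (det_map R (xi := fun=> y) (alpha g)) \in U.
    by apply: (invariant_subspaceP U).1.
  have diff : act Phi (det_map R (xi := fun=> y) (alpha (dfwith outp0 b))) -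
      act Phi (det_map R (xi := fun=> y) (alpha outp0)) =
      (Phi (delta (ev b)) - Phi (delta (ev (outp0 x)))) *: dualb R (ev i).
    apply/lfunP => v; rewrite add_lfunE opp_lfunE !act_det_map -sumrB.
    rewrite (bigD1 x) //= [X in _ + X]big1 => [|x' x'x]; last first.
      rewrite -sumrB big1 // => a _; rewrite /alpha dfwith_out 1?eq_sym //.
      by rewrite if_same subrr.
    rewrite addr0 -sumrB (bigD1 i) //= big1 => [|a /negPf ai].
      by rewrite /alpha eqxx dfwith_in addr0 -mulrBl scale_lfunE dualbE.
    by rewrite /alpha ai subrr.
  have := memvB (Uact (dfwith outp0 b)) (Uact outp0).
  by rewrite diff rpredZeq subr_eq0 ?(negPf nconst).
apply/eqP; rewrite eqEsubv subvf /=; apply/subvP => Psi _.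
rewrite (dual_sum_dualb Psi); apply: memv_suml => y _; apply: memv_suml => i _.
by rewrite memvZ.
Qed.

Lemma invariant_classification U :
  invariant_subspace U -> U \in [:: 0; S; S + Z; fullv]%VS.
Proof.
move=> invU; rewrite !inE.
have [US | nUS] := boolP (U <= S)%VS.
  have [// | U0] := eqVneq U 0%VS.
  by rewrite (invariant_in_S invU US U0) eqxx orbT.
have [USZ | nUSZ] := boolP (U <= S + Z)%VS.
  by rewrite (invariant_in_SZ invU USZ nUS) eqxx !orbT.
by rewrite (invariant_notin_SZ invU nUSZ) eqxx !orbT.
Qed.

(** * Directness of the sums, proved with test vectors, and S + Z + C as the whole dual *)

Definition indicator (P : pred (event A)) : space := [ffun j => (P j)%:R].

Lemma sigma_apply_tag x y :
  sigma x (indicator (fun j => tag j == y)) = (A x * (x == y))%:R.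
Proof.
rewrite sigmaE; under eq_bigr do rewrite ffunE /=.
by rewrite sumr_const card_ord -mulrnA mulnC.
Qed.

Lemma sigma_apply_first x :
  sigma x (indicator (fun j => tagged j == 0 :> nat)) = 1.
Proof.
rewrite sigmaE (bigD1 (outp0 x)) //= big1 => [|a a0].
  by rewrite ffunE addr0.
by rewrite ffunE; have /negPf-> : (a : nat) != 0%N by [].
Qed.

(** Evaluation at the indicator of all first outputs kills S, where coefficients sum to zero, and
    sends [k *: tau] to [k]. *)
Lemma directv_SZ : directv (S + Z).
Proof.
apply/directv_addP/eqP; rewrite -subv0; apply/subvP => v.
rewrite memv_cap memv0 => /andP[/memSP[c [c0 ec]] /vlineP[k ek]].
pose first := indicator (fun j => tagged j == 0 :> nat).
have := congr1 (fun Phi : dual => Phi first) (etrans (esym ec) ek).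
rewrite /= sum_lfunE; under eq_bigr do rewrite scale_lfunE sigma_apply_first.
rewrite !scale_lfunE sum_lfunE.
under [X in _ = _ *: (_ *: X)]eq_bigr do rewrite sigma_apply_first.
rewrite -scaler_suml c0 scale0r sumr_const card_ord.
rewrite /GRing.scale /= mulVf // mulr1.
by move=> k0; rewrite ek -k0 scale0r.
Qed.

Lemma C_apply_tag Phi y :
  Phi \in C -> Phi (indicator (fun j => tag j == y)) = 0.
Proof.
move: Phi; apply: span_ind => [|u v u0 v0|k u u0|_ /imageP[[x a] _ ->]].
- by rewrite zero_lfunE.
- by rewrite add_lfunE u0 v0 addr0.
- by rewrite scale_lfunE u0 scaler0.
rewrite add_lfunE opp_lfunE scale_lfunE dualbE sigma_apply_tag ffunE /=.
by rewrite natrM subrr.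
Qed.

(** The indicator of the outputs of input [y] kills C but reads off [c y] times [A y] on S + Z, and
    [A y] is positive. *)
Lemma directv_SZC : directv (S + Z + C).
Proof.
rewrite directv_addE directv_SZ directv_trivial /=.
rewrite -subv0; apply/subvP => v.
rewrite memv_cap memv0 => /andP[/memSZP[c ->] Cv].
rewrite big1 // => y _; have := C_apply_tag y Cv.
rewrite sum_lfunE (bigD1 y) //= big1 => [|x /negPf xy]; last first.
  by rewrite scale_lfunE sigma_apply_tag xy muln0 scaler0.
rewrite scale_lfunE sigma_apply_tag eqxx muln1 addr0.
move/eqP; rewrite mulf_eq0 pnatr_eq0 -leqn0 leqNgt Apos orbF => /eqP->.
by rewrite scale0r.
Qed.

Lemma addv_SZC : (S + Z + C)%VS = fullv.
Proof.
have mem_not_last (j : event A) :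
    ((tagged j).+1 < A (tag j))%N -> dualb R j \in (S + Z + C)%VS.
  move=> jlt; have A0 : (A (tag j))%:R != 0 :> R by rewrite pnatr_eq0 -lt0n.
  (* For an output that is not the last, [A (tag j)] times the dual basis vector is [gamma j] plus
     [sigma (tag j)]. *)
  rewrite -(scalerK A0 (dualb R j)) memvZ // -(subrK (sigma (tag j)) (_ *: _)).
  rewrite addrC memv_add ?sigma_mem // memv_span //.
  by apply/imageP; exists j.
apply/eqP; rewrite eqEsubv subvf /=; apply/subvP => Phi _.
rewrite (dual_sum_dualb Phi); apply: memv_suml => x _; apply: memv_suml => a _.
rewrite memvZ //; have [lt_a | le_a] := boolP (a.+1 < A x)%N.
  exact: mem_not_last.
(* The last output is recovered as [sigma x] minus all the other outputs of [x]. *)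
rewrite -[dualb R _](addrK (\sum_(b < A x | b != a) dualb R (ev b))) memvB //.
  rewrite -(bigD1 a (P := predT)) //=.
  exact: subvP (addvSl _ _) _ (sigma_mem x).
apply: memv_suml => b ba; apply: mem_not_last => /=.
apply: leq_ltn_trans (ltn_ord a); rewrite ltn_neqAle ba -ltnS.
by apply: leq_trans (ltn_ord b) _; rewrite leqNgt.
Qed.

End Devices.

(** * When the invariant subspaces form a chain, it is the unique irreducible chain *)

Section InvariantChains.
Variables (R : realType) (n : nat) (A : 'I_n.+1 -> nat).
Variable t : seq {vspace dual R A}.
Hypotheses (invariantE : forall U, invariant_subspace U <-> U \in t)
  (sorted_t : sorted (@propersubv _ _) t).

Lemma irreducible_chain_invariants : irreducible_chain t.
Proof.
split=> // [||U | i lit].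
- exact/(ohead_sorted sorted_t)/invariantE/invariant_0.
- exact/(last_sorted sorted_t)/invariantE/invariant_fullv.
- by move/invariantE.
set U := nth _ _ i; set V := nth _ _ i.+1.
have /andP[UV _] : propersubv U V.
  exact: (sorted_ltn_nth (@propersubv_trans _ _)) (ltnW lit) lit (ltnSn i).
(* The preimage is an invariant subspace between two consecutive terms of [t], hence one of them. *)
move=> W WV invW; pose W' := (quot_map U @^-1: W)%VS.
have imW' : (quot_map U @: W')%VS = W by rewrite lpreimK // limg_quot_map subvf.
have tW' : W' \in t.
  by apply/invariantE => L locL Phi; rewrite -!memv_preim; apply: invW.
have UW' : (U <= W')%VS.
  apply/subvP => Phi; rewrite -{1}(lker_quot_map U) memv_ker -memv_preim.
  by move/eqP->; rewrite mem0v.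
have W'V : (W' <= V)%VS.
  apply/subvP => Phi; rewrite -memv_preim => /(subvP WV).
  by rewrite mem_quot_map_img.
have [eW | eW] := between_nth_sorted sorted_t lit tW' UW' W'V.
  left; apply/eqP; rewrite -imW' eW -subv0; apply/subvP => _ /memv_imgP[u Uu ->].
  by rewrite memv0 -memv_ker lker_quot_map.
by right; rewrite -imW' eW.
Qed.

(** Strictly sorted sequences with the same members are equal. A member [V] of [t] missing from [s]
    would lie strictly between two consecutive terms of [s] and make their quotient reducible. *)
Lemma irreducible_chain_unique s : irreducible_chain s -> s = t.
Proof.
case=> head_s last_s sorted_s inv_s irr_s.
apply: (irr_sorted_eq (@propersubv_trans _ _) (@propersubvv _ _)) => // V.
apply/idP/idP => [/inv_s/invariantE // | tV]; apply: contraT => nsV.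
have total U : U \in t -> (U <= V)%VS || (V <= U)%VS.
  have mono i j : (i < j)%N -> (j < size t)%N ->
      (nth 0%VS t i <= nth 0%VS t j)%VS.
    move=> ij jt; suff /andP[] : propersubv (nth 0%VS t i) (nth 0%VS t j) by [].
    exact: (sorted_ltn_nth (@propersubv_trans _ _)) (ltn_trans ij jt) jt ij.
  move=> tU; rewrite -(nth_index 0%VS tU) -(nth_index 0%VS tV).
  have [UV | VU | ->] := ltngtP (index U t) (index V t); last by rewrite subvv.
    by rewrite mono ?index_mem.
  by rewrite orbC mono ?index_mem.
have s0 : s != [::] by case: (s) head_s.
have has_s : has (fun U => V <= U)%VS s.
  apply/hasP; exists fullv; last exact: subvf.
  by rewrite -last_s; case: (s) s0 => // U s' _; exact: (mem_last U s').
(* Locate the first term of [s] containing [V]. Index 0 is excluded, since it would force [V] to be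
   the zero space, which is in [s]; so that term has a predecessor. *)
case i_def: (find (fun U => V <= U)%VS s) (has_s) => [|i]; rewrite has_find i_def.
  move=> s_gt0; have := nth_find 0%VS has_s; rewrite i_def /=.
  have s00 : nth 0%VS s 0 = 0%VS by case: (s) head_s => // U s' [].
  rewrite s00 subv0 => /eqP V0; case/negP: nsV.
  by rewrite V0 -s00 mem_nth.
move=> lis; set U := nth 0%VS s i; pose W := nth 0%VS s i.+1.
have sU : U \in s by rewrite mem_nth // ltnW.
have VW : (V <= W)%VS by rewrite /W -i_def; apply: nth_find has_s.
have nVU : ~~ (V <= U)%VS by rewrite (before_find 0%VS) // i_def.
have UV : (U <= V)%VS.
  by have := total U; rewrite (negPf nVU) orbF; apply; apply/invariantE/inv_s.
have imVW : (quot_map U @: V <= quot_map U @: W)%VS by apply: limgS.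
have [||q0 | qW] := irr_s i lis (quot_map U @: V)%VS => //.
- move=> L locL Phi; rewrite !mem_quot_map_img //.
  by apply: (invariantE V).2.
- case/negP: nVU; apply/subvP => Phi /(memv_img (quot_map U)).
  by rewrite q0 memv0 -memv_ker lker_quot_map.
(* [V] and [W] both contain [U] and have the same image modulo [U], so they coincide. *)
case/negP: nsV; suff -> : V = W by apply: mem_nth.
apply/eqP; rewrite eqEsubv VW; apply/subvP => Phi /(memv_img (quot_map U)).
by rewrite -qW mem_quot_map_img.
Qed.

End InvariantChains.

Theorem corollary2 (R : realType) (n : nat) (A : 'I_n.+1 -> nat)
    (Apos : forall x, (0 < A x)%N) :
  let S := Sstar R A in
  let Z := Zstar R A in
  let C := Cstar R A in
  let series := [:: 0; S; S + Z; S + Z + C]%VS in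
  [/\ directv (S + Z),
      directv (S + Z + C),
      (S + Z + C)%VS = fullv
    & sorted (fun U V => U <= V)%VS series] /\
  [/\ forall U, U \in series -> invariant_subspace U,
      irreducible_chain (undup series)
    & forall s, irreducible_chain s -> s = undup series].
Proof.
move=> S Z C series.
have sorted_series : sorted (fun U V => U <= V)%VS series.
  by rewrite /= sub0v !addvSl.
split.
  by split=> //; [apply: directv_SZ | apply: directv_SZC | apply: addv_SZC].
have invE U : invariant_subspace U <-> U \in series.
  split; first by move/(invariant_classification Apos); rewrite /series addv_SZC.
  rewrite /series addv_SZC // !inE => /or4P[] /eqP->.
  - exact: invariant_0.
  - exact: invariant_S.
  - exact: invariant_SZ.
  - exact: invariant_fullv.
(* Terms can repeat: S is zero for a single input, and C is zero if every input has one output. *)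
have invE' U : invariant_subspace U <-> U \in undup series.
  by rewrite mem_undup.
have sorted_undup := sorted_subv_undup sorted_series.
split=> [U /invE // ||s].
  exact: irreducible_chain_invariants.
exact: irreducible_chain_unique.
Qed.
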